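(* For uniform metrical task systems with a PST oracle whose prediction error is at most $\eta_0$, the LPS algorithm makes the fewest state transitions per phase out of all deterministic BLS phase algorithms (with access to the PST oracle) when considering each algorithm's worst case input.
   Context: Uniform metrical task system: a finite set $S$ of $n$ states with transition costs $d(s,s')=1$ for $s\ne s'$ and $d(s,s)=0$. A task is an array $T$ of length $n$, where $T[i]$ is the cost of processing it in state $s_i$. The input is a sequence of tasks, one per time step; an online algorithm chooses at each time $t$ a state, knowing only the tasks up to time $t$, its past states, and any oracle advice, and pays transition costs plus processing costs. Phases and saturation: at the start of a phase all states are unsaturated. A state $s$ is saturated at time $t$ if the total cost of processing, in state $s$, all tasks arriving from the start of the phase through time $t$ is at least $1$; its saturation time in the phase is the first such $t$. When all states are saturated the next phase begins and all states are again unsaturated. A BLS phase algorithm is an algorithm that runs in phases, never processes tasks in a saturated state, and only leaves its current state when that state becomes saturated. PST (Predicted Saturation Time) oracle: at the beginning of each phase it outputs an array $h$ without ties, where $h[i]$ is the predicted saturation time of state $s_i$ in that phase. If $t_i$ is the true saturation time of $s_i$, the prediction error is $\eta=\sum_{i=1}^n |h[i]-t_i|$. A worst case input is chosen by an adversary who controls both the task sequence and the oracle's predictions, subject to $\eta\le\eta_0$ (with the same $\eta_0$ for all algorithms compared). LPS (Last Predicted State) algorithm: the BLS phase algorithm which queries the PST oracle at the beginning of each phase and always transitions to the unsaturated state with the latest predicted saturation time (at the start of the phase, and whenever its current state becomes saturated while unsaturated states remain). *)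

(* Defs.v *)
From HB Require Import structures.
From mathcomp Require Import all_boot all_order all_algebra.
Set Implicit Arguments.
Unset Strict Implicit.
Unset Printing Implicit Defensive.
Import Order.TTheory GRing.Theory Num.Theory.
Local Open Scope ring_scope.

(* n.+1 states, so that the state space is nonempty. *)
Notation state n := 'I_n.+1.

Definition dist (n : nat) (s s' : state n) : nat := (s != s').

(* [task u] arrives at time u >= 1 ([task 0] is never used), and
   [prediction j] is the output of the oracle at the beginning of the j-th
   phase; like saturation times, predicted times are absolute (they are not
   counted from the start of the phase). *)
Record input (R : realFieldType) (n : nat) := Input {
  task : nat -> state n -> R;
  prediction : nat -> state n -> R;
  task_ge0 : forall u s, 0 <= task u s;
  prediction_inj : forall j, injective (prediction j)
}.

Section Phases.
Variables (R : realFieldType) (n : nat) (I : input R n).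

(* Cost of processing in s the tasks of a phase that starts at time b, up to
   and including time t.  The task arriving at time b belongs to the previous
   phase, whose last unsaturated states it saturates. *)
Definition phase_cost (b t : nat) (s : state n) : R :=
  \sum_(b.+1 <= u < t.+1) task I u s.

Definition saturated_since (b t : nat) (s : state n) : bool :=
  1 <= phase_cost b t s.

(* The pair (index, starting time) of the phase in progress at time t.  Hence
   [clock b = (j, b)] means that the j-th phase starts exactly at time b. *)
Fixpoint clock (t : nat) : nat * nat :=
  if t is u.+1 then
    let: (j, b) := clock u in
    if [forall s, saturated_since b t s] then (j.+1, t) else (j, b)
  else (0%N, 0%N).

Definition phase (t : nat) : nat := (clock t).1.

Definition phase_start (t : nat) : nat := (clock t).2.

Definition saturated (t : nat) (s : state n) : bool :=
  saturated_since (phase_start t) t s.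

(* The j-th phase starts at time b and is completed at time e. *)
Definition phase_span (j b e : nat) : Prop :=
  clock b = (j, b) /\ clock e = (j.+1, e).

(* First t at which s is saturated, for a phase that starts at time b and is
   completed at time e (so that the search succeeds). *)
Definition saturation_time (b e : nat) (s : state n) : nat :=
  find (fun t => saturated_since b t s) (iota 0 e.+1).

Definition prediction_error (j b e : nat) : R :=
  \sum_(s : state n) `|prediction I j s - (saturation_time b e s)%:R|.

(* True saturation times, hence the error, only make sense for the completed
   phases; a last phase may be left incomplete. *)
Definition error_bounded (eta0 : R) : Prop :=
  forall j b e, phase_span j b e -> prediction_error j b e <= eta0.

End Phases.

(* [A I t] is the state chosen at time t on input I.  If a phase starts at
   time t (in particular for t = 0), it is the state in which the algorithm
   starts that phase. *)
Definition algorithm (R : realFieldType) (n : nat) : Type :=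
  input R n -> nat -> state n.

(* The state chosen at time t depends only on the tasks up to time t and on the
   predictions for the phases begun by time t; the past states of a
   deterministic algorithm are functions of these data. *)
Definition online (R : realFieldType) (n : nat) (A : algorithm R n) : Prop :=
  forall (I I' : input R n) (t : nat),
    (forall u, (0 < u <= t)%N -> task I u =1 task I' u) ->
    (forall j, (j <= phase I t)%N -> prediction I j =1 prediction I' j) ->
    A I t = A I' t.

(* When a new phase starts the current state has just become saturated, so the
   algorithm may start the new phase in any state. *)
Record BLS_phase_algorithm (R : realFieldType) (n : nat)
    (A : algorithm R n) : Prop := BLSPhaseAlgorithm {
  BLS_online : online A;
  BLS_unsaturated : forall I t, ~~ saturated I t (A I t);
  BLS_stay : forall I t, phase I t.+1 = phase I t ->
    ~~ saturated I t.+1 (A I t) -> A I t.+1 = A I t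
}.

(* At every time some state is unsaturated, so the default ord0 is harmless. *)
Definition latest_unsaturated (R : realFieldType) (n : nat)
    (I : input R n) (t : nat) : state n :=
  [arg max_(s > ord0 | ~~ saturated I t s) prediction I (phase I t) s]%O.

Fixpoint LPS (R : realFieldType) (n : nat) (I : input R n) (t : nat) :
    state n :=
  if t is u.+1 then
    let s := LPS I u in
    if (phase I t == phase I u) && ~~ saturated I t s then s
    else latest_unsaturated I t
  else latest_unsaturated I 0.

(* Number of transitions during a phase that starts at time b and is completed
   at time e.  The choices of a starting state, made at times b and e, are not
   counted: there is one per phase, whatever the algorithm. *)
Definition transitions (R : realFieldType) (n : nat) (A : algorithm R n)
    (I : input R n) (b e : nat) : nat :=
  \sum_(b.+1 <= t < e) dist (A I t.-1) (A I t).

(* w is the maximal number of transitions of A in the j-th phase, over all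
   inputs whose prediction errors are at most eta0. *)
Definition worst_case_transitions (R : realFieldType) (n : nat) (eta0 : R)
    (A : algorithm R n) (j w : nat) : Prop :=
  (exists I b e, [/\ error_bounded I eta0, phase_span I j b e
                   & transitions A I b e = w]) /\
  (forall I b e, error_bounded I eta0 -> phase_span I j b e ->
     (transitions A I b e <= w)%N).

(* Main.v *)
(* If LPS makes k > 0 transitions in a phase, then the k + 1 states it visits
   have increasing saturation times and decreasing predictions.  Saturation
   times being distinct integers, and predictions being distinct, the error is
   then larger than E := \sum_(i <= k) |k/2 - i|.
   Conversely, an error larger than E suffices to force k transitions on any BLS
   phase algorithm: keep the past of LPS's input, predict k + 1 states for
   almost the same time, saturate all other states at once, and then saturate at
   each step the state which the algorithm occupies.  The k + 1 saturation times
   are consecutive, and predictions close to their mean give an error close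
   to E. *)
Require Import Defs.
From HB Require Import structures.
From mathcomp Require Import all_boot all_order all_algebra.
From mathcomp Require Import zify lra.
From Stdlib Require Import Classical.
Set Implicit Arguments.
Unset Strict Implicit.
Unset Printing Implicit Defensive.
Import Order.TTheory GRing.Theory Num.Theory.
Local Open Scope ring_scope.

(** Excluded middle decides whether the bound is attained; if not, the bound drops by one. *)
Lemma ex_max_bounded (P : nat -> Prop) (N : nat) :
  (exists k, P k) -> (forall k, P k -> (k <= N)%N) ->
  exists w, P w /\ forall k, P k -> (k <= w)%N.
Proof.
elim: N => [|N IH] [k Pk] le_N.
  by exists k; have := le_N _ Pk; case: k Pk.
have [PN|nPN] := classic (P N.+1); first by exists N.+1.
apply: IH; first by exists k.
move=> m Pm; have := le_N _ Pm; rewrite leq_eqVlt => /predU1P[Em|//].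
by rewrite Em in Pm.
Qed.

(** * The phase clock and saturation times *)

Section Clock.
Variables (R : realFieldType) (n : nat) (I : input R n).

Lemma clockS t :
  clock I t.+1 =
    if [forall s, saturated_since I (phase_start I t) t.+1 s]
    then ((phase I t).+1, t.+1) else clock I t.
Proof. by rewrite /= /phase_start /phase; case: (clock I t). Qed.

Lemma phaseS t : (phase I t <= phase I t.+1)%N.
Proof. by rewrite {2}/phase clockS; case: ifP => //= _; exact: leqnSn. Qed.

Lemma phase_homo : {homo phase I : t u / (t <= u)%N}.
Proof. by apply: homo_leq => //; [exact: leq_trans|exact: phaseS]. Qed.

Lemma phase_start_le t : (phase_start I t <= t)%N.
Proof.
elim: t => // t IH; rewrite {1}/phase_start clockS; case: ifP => //= _.
exact: leq_trans IH (leqnSn t).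
Qed.

(** The clock changes only when its index increases, so the index determines the starting time. *)
Lemma eq_clock t u : phase I t = phase I u -> clock I t = clock I u.
Proof.
wlog le_tu : t u / (t <= u)%N => [Hw Etu|].
  by case/orP: (leq_total t u) => /Hw ->.
elim: u le_tu => [|u IH]; first by rewrite leqn0 => /eqP ->.
rewrite leq_eqVlt => /predU1P[-> //|]; rewrite ltnS => le_tu Etu.
have Eu : phase I t = phase I u.
  by apply/eqP; rewrite eqn_leq phase_homo //= Etu phaseS.
rewrite (IH le_tu Eu); move: Etu; rewrite Eu {2}/phase clockS.
by case: ifP => //= _ /eqP; rewrite ltn_eqF.
Qed.

(** When a phase has just started, its cost is an empty sum; at any other time, the test that would
    have ended the phase has failed. *)
Lemma ex_unsaturated t : exists s, ~~ saturated I t s.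
Proof.
have cost0 v : ~~ saturated_since I v v ord0.
  by rewrite /saturated_since /phase_cost big_geq // -ltNge ltr01.
case: t => [|t]; first by exists ord0; exact: cost0.
rewrite /saturated {1}/phase_start clockS; case: ifPn => /= [_|].
  by exists ord0; exact: cost0.
by rewrite negb_forall => /existsP[s us]; exists s.
Qed.

Lemma saturated_since_homo b t u s : (t <= u)%N ->
  saturated_since I b t s -> saturated_since I b u s.
Proof.
move=> le_tu; rewrite /saturated_since /phase_cost => /le_trans; apply.
have [le_bt|lt_tb] := leqP b t.
  rewrite [leRHS](@big_cat_nat _ _ _ t.+1) //= lerDl.
  by apply: sumr_ge0 => i _; exact: task_ge0.
rewrite big_geq ?(leqW lt_tb) //; apply: sumr_ge0 => i _; exact: task_ge0.
Qed.

Lemma saturation_time_eq b e s t0 : (t0 <= e)%N ->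
  saturated_since I b t0 s ->
  (forall t, (t < t0)%N -> ~~ saturated_since I b t s) ->
  saturation_time I b e s = t0.
Proof.
move=> le0 sat0 unsat; rewrite /saturation_time.
have hasp : has (saturated_since I b ^~ s) (iota 0 e.+1).
  by apply/hasP; exists t0 => //; rewrite mem_iota.
have := nth_find 0%N hasp; have := hasp; rewrite has_find size_iota => lt_f.
rewrite nth_iota // add0n => satf.
apply/eqP; rewrite eqn_leq; apply/andP; split; rewrite leqNgt; apply/negP.
  move=> /(before_find 0%N); rewrite nth_iota ?ltnS // add0n.
  by rewrite sat0.
by move=> /unsat /negP; apply.
Qed.

Section Span.
Variables (j b e : nat).
Hypothesis span : phase_span I j b e.

Lemma phase_span_lt : (b < e)%N.
Proof.
case: span => Eb Ee; rewrite ltnNge; apply/negP => /phase_homo.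
by rewrite /phase Eb Ee /= ltnn.
Qed.

Lemma phase_span_clock t : (b <= t < e)%N -> clock I t = (j, b).
Proof.
case: span => Eb Ee /andP[le_bt lt_te].
have [Et|nEt] := eqVneq (phase I t) j.
  by rewrite -Eb; apply: eq_clock; rewrite Et /phase Eb.
(* The index is squeezed between [j] and [j.+1]. Were it [j.+1], the clock would agree with that at
   [e], whose starting time is later than [t]. *)
have Etj : phase I t = j.+1.
  have [phb phe] : phase I b = j /\ phase I e = j.+1 by rewrite /phase Eb Ee.
  have := phase_homo le_bt; have := phase_homo (ltnW lt_te).
  by rewrite phb phe; move: nEt; lia.
have : clock I t = clock I e by apply: eq_clock; rewrite Etj /phase Ee.
rewrite Ee => Ec; have := phase_start_le t.
by rewrite /phase_start Ec /= leqNgt lt_te.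
Qed.

Lemma phase_span_all_saturated s : saturated_since I b e s.
Proof.
have lt_be := phase_span_lt.
have Ep : clock I e.-1 = (j, b) by apply: phase_span_clock; lia.
case: span => _; rewrite -(prednK (leq_ltn_trans (leq0n b) lt_be)) clockS.
rewrite {1}/phase_start Ep /=; case: ifP => [/forallP/(_ s)//|_ []].
by move=> /eqP; rewrite ltn_eqF.
Qed.

(** Saturation persists within a phase. Time [e] is excluded because the clock has been reset
    there. *)
Lemma saturatedE t s : (b <= t < e)%N ->
  saturated I t s = (saturation_time I b e s <= t)%N.
Proof.
move=> bte; rewrite /saturated /phase_start (phase_span_clock bte) /=.
have hasp : has (saturated_since I b ^~ s) (iota 0 e.+1).
  apply/hasP; exists e; first by rewrite mem_iota /= add0n.
  exact: phase_span_all_saturated.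
have := nth_find 0%N hasp; have := hasp; rewrite has_find size_iota => lt_f.
rewrite nth_iota // add0n -/(saturation_time I b e s) => satf.
have [le_ft|lt_tf] := leqP; first exact: saturated_since_homo satf.
have := before_find 0%N lt_tf; rewrite nth_iota ?add0n //.
by case/andP: bte => _ /leq_trans; apply.
Qed.

(** Deleting repetitions from the run of [A] leaves one entry per transition after [s0]. *)
Lemma transitions_path (A : algorithm R n) (r : rel (state n)) :
  (forall t, (b <= t)%N -> (t.+1 < e)%N -> A I t != A I t.+1 ->
     r (A I t) (A I t.+1)) ->
  exists s0 l, path r s0 l /\ size l = transitions A I b e.
Proof.
move=> rA; rewrite /transitions.
suff main t : (b <= t < e)%N -> exists s0 l,
    [/\ path r s0 l, last s0 l = A I t
      & size l = \sum_(b.+1 <= u < t.+1) dist (A I u.-1) (A I u)].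
  have lt_be := phase_span_lt.
  have [|s0 [l [pl _ sl]]] := main e.-1; first by lia.
  exists s0, l; split=> //; rewrite sl prednK //; lia.
elim: t => [|t IH] /andP[].
  rewrite leqn0 => /eqP Eb _; exists (A I 0%N), [::].
  by rewrite Eb big_geq.
rewrite leq_eqVlt => /predU1P[Eb _|].
  by exists (A I t.+1), [::]; rewrite Eb big_geq.
rewrite ltnS => le_bt lt_te; have [|s0 [l [pl ll sl]]] := IH.
  by rewrite le_bt ltnW.
have [Es|nEs] := eqVneq (A I t) (A I t.+1).
  exists s0, l; split=> //; first by rewrite -Es.
  by rewrite big_nat_recr //= -sl -Es /dist eqxx addr0.
exists s0, (rcons l (A I t.+1)); split.
- by rewrite rcons_path pl ll rA.
- by rewrite last_rcons.
- by rewrite size_rcons big_nat_recr //= /dist nEs -sl; exact: esym (addn1 _).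
Qed.

(** A BLS algorithm only leaves a state saturated at time [t.+1], and enters one that is unsaturated
    then. *)
Lemma BLS_transition_saturation_time (A : algorithm R n) t :
  BLS_phase_algorithm A -> (b <= t)%N -> (t.+1 < e)%N ->
  A I t != A I t.+1 ->
  (saturation_time I b e (A I t) < saturation_time I b e (A I t.+1))%N.
Proof.
move=> BA le_bt lt_te nEA.
have bt : (b <= t < e)%N by lia.
have bt1 : (b <= t.+1 < e)%N by lia.
have := BLS_unsaturated BA I t.+1; rewrite (saturatedE _ bt1) -ltnNge.
apply: leq_ltn_trans; rewrite -(saturatedE _ bt1).
apply: contraNT nEA => /(BLS_stay BA) -> //.
by rewrite /phase (phase_span_clock bt) (phase_span_clock bt1).
Qed.

(** Saturation times strictly increase along the visited states, so no state is visited twice. *)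
Lemma BLS_transitions_le (A : algorithm R n) :
  BLS_phase_algorithm A -> (transitions A I b e <= n)%N.
Proof.
move=> BA.
have [|s0 [l [pl <-]]] := @transitions_path A
  (relpre (saturation_time I b e) ltn).
  by move=> t; exact: BLS_transition_saturation_time.
have : uniq (s0 :: l).
  apply: (@sorted_uniq _ (relpre (saturation_time I b e) ltn)) => //.
  - by move=> ? ? ?; exact: ltn_trans.
  - by move=> ?; exact: ltnn.
move=> /card_uniqP uniq_size.
by rewrite -ltnS -[leqRHS]card_ord -[leqLHS]uniq_size max_card.
Qed.

End Span.
End Clock.

(** * Dependence of costs and clock on the past tasks *)

Lemma eq_phase_cost (R : realFieldType) (n : nat) (I I' : input R n) b t s :
  (forall u, (0 < u <= t)%N -> task I u =1 task I' u) ->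
  phase_cost I b t s = phase_cost I' b t s.
Proof.
by move=> eqt; apply: eq_big_nat => u /andP[lt_bu le_ut]; apply: eqt; lia.
Qed.

Lemma eq_clock_task (R : realFieldType) (n : nat) (I I' : input R n) t :
  (forall u, (0 < u <= t)%N -> task I u =1 task I' u) -> clock I t = clock I' t.
Proof.
elim: t => // t IH eqt.
have Et : clock I t = clock I' t by apply: IH => u ut; apply: eqt; lia.
rewrite !clockS /phase_start /phase -Et.
have -> // : [forall s, saturated_since I (clock I t).2 t.+1 s]
  = [forall s, saturated_since I' (clock I t).2 t.+1 s].
by apply: eq_forallb => s; rewrite /saturated_since (eq_phase_cost _ _ eqt).
Qed.

(** * LPS and the prediction error that its transitions require *)

Section LPS.
Variables (R : realFieldType) (n : nat).

(** As [ord0] may be saturated, a maximum is first obtained from some unsaturated state; it shows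
    that the search does not fall back on the default. *)
Lemma latest_unsaturatedP (I : input R n) t :
  ~~ saturated I t (latest_unsaturated I t) /\
  forall s, ~~ saturated I t s ->
    prediction I (phase I t) s
      <= prediction I (phase I t) (latest_unsaturated I t).
Proof.
rewrite /latest_unsaturated /Order.arg_max /extremum.
case: pickP => [s /andP[us /forallP maxs]|nopick] /=.
  by split=> // s' us'; have /implyP := maxs s'; apply.
have [s us] := ex_unsaturated I t.
have [s1 us1 max1] := @arg_maxP _ _ _ s (fun s => ~~ saturated I t s)
  (prediction I (phase I t)) us.
have := nopick s1; rewrite /= us1 /= => /forallP; case=> s2.
by apply/implyP; exact: max1.
Qed.

(** Within a phase the unsaturated states only become fewer, so a state of maximal prediction stays
    maximal until it is saturated. *)
Lemma LPS_latest (I : input R n) t :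
  ~~ saturated I t (LPS I t) /\
  forall s, ~~ saturated I t s ->
    prediction I (phase I t) s <= prediction I (phase I t) (LPS I t).
Proof.
elim: t => [|t [_ maxt]]; first exact: latest_unsaturatedP.
rewrite [LPS I t.+1]/=; case: ifP => [/andP[/eqP Ep us]|_]; last first.
  exact: latest_unsaturatedP.
split=> // s us1; rewrite Ep; apply: maxt; apply: contra us1.
rewrite /saturated {2}/phase_start (eq_clock Ep).
exact: saturated_since_homo.
Qed.

Lemma LPS_BLS : BLS_phase_algorithm (@LPS R n).
Proof.
split=> [I I' t eqt eqp|I t|I t Ep us]; last 2 first.
- by case: (LPS_latest I t).
- by rewrite /= Ep eqxx us.
have eqc u : (u <= t)%N -> clock I u = clock I' u.
  by move=> le_ut; apply: eq_clock_task => v vu; apply: eqt; lia.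
have eqs u s : (u <= t)%N -> saturated I u s = saturated I' u s.
  move=> le_ut; rewrite /saturated /phase_start eqc // /saturated_since.
  by rewrite (@eq_phase_cost _ _ I I') // => v vu; apply: eqt; lia.
have eql u : (u <= t)%N -> latest_unsaturated I u = latest_unsaturated I' u.
  move=> le_ut; rewrite /latest_unsaturated /Order.arg_max /extremum.
  congr odflt; apply: eq_pick => s /=; rewrite eqs //; congr (_ && _).
  have eqpu : prediction I (phase I u) =1 prediction I' (phase I' u).
    by move=> s'; rewrite eqp ?phase_homo // /phase eqc.
  by apply: eq_forallb => s'; rewrite eqs // !eqpu.
elim: t eqc eqs eql {eqt eqp} => [|t IH] eqc eqs eql /=; first exact: eql.
have eqA : LPS I t = LPS I' t.
  by apply: IH => u *; [apply: eqc|apply: eqs|apply: eql]; lia.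
by rewrite eqA eqs // eql // /phase !eqc.
Qed.

(** The state entered was already unsaturated at time [t], when [LPS] preferred the one it leaves;
    absence of ties makes this strict. *)
Lemma LPS_transition_prediction (I : input R n) j b e t :
  phase_span I j b e -> (b <= t)%N -> (t.+1 < e)%N ->
  LPS I t != LPS I t.+1 ->
  prediction I j (LPS I t.+1) < prediction I j (LPS I t).
Proof.
move=> span le_bt lt_te nE.
have bt : (b <= t < e)%N by lia.
have bt1 : (b <= t.+1 < e)%N by lia.
have [us1 _] := LPS_latest I t.+1; have [_ maxt] := LPS_latest I t.
rewrite lt_neqAle (inj_eq (@prediction_inj _ _ I j)) eq_sym nE andTb.
move: maxt; rewrite /phase (phase_span_clock span bt); apply.
by apply: contra us1; rewrite !(saturatedE span) //; exact: leqW.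
Qed.

(* Replace [h i - tau i] by [g i - i], where [g] is decreasing.  Then weight the
   i-th term by the sign of [k / 2 - i]: these weights have sum 0, so [g] may be
   shifted to vanish at [k./2], where it changes sign together with them. *)
Lemma reversed_order_error (h : nat -> R) (tau : nat -> nat) (k : nat) :
  (0 < k)%N ->
  (forall i, (i < k)%N -> h i.+1 < h i) ->
  (forall i, (i < k)%N -> (tau i < tau i.+1)%N) ->
  \sum_(i < k.+1) `|k%:R / 2 - i%:R| < \sum_(i < k.+1) `|h i - (tau i)%:R|.
Proof.
move=> k_gt0 h_dec tau_inc.
pose g i : R := h i - (tau i)%:R + i%:R.
(* At each step [tau] grows by at least 1, which offsets the added [i], so [g] inherits the strict
   decrease of [h]. *)
have g_dec i m : (i < m <= k)%N -> g m < g i.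
  elim: m => [|m IH]; rewrite ?ltn0 // ltnS => /andP[le_im lt_mk].
  have gS : g m.+1 < g m.
    have := h_dec _ lt_mk; have := tau_inc _ lt_mk.
    rewrite -(ler_nat R) /g -[in (m.+1)%:R]natr1 -[(tau m).+1%:R]natr1; lra.
  move: le_im; rewrite leq_eqVlt => /predU1P[-> //|lt_im].
  by apply: lt_trans gS (IH _); rewrite lt_im ltnW.
pose sigma i : R := Num.sg (k%:R / 2 - i%:R).
pose m := g k./2.
have sigma_sum : \sum_(i < k.+1) sigma i = 0.
  (* The reflection of [i] to [k - i] flips every sign. *)
  suff : \sum_(i < k.+1) sigma i = - \sum_(i < k.+1) sigma i by lra.
  rewrite {1}(reindex_inj rev_ord_inj) -sumrN; apply: eq_bigr => i _.
  rewrite /sigma -sgrN; congr Num.sg; rewrite /= subSS natrB; last first.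
    by rewrite -ltnS.
  lra.
have half (i : nat) : (i%:R < k%:R / 2 :> R) = (i.*2 < k)%N.
  rewrite -(ltr_nat R) -muln2 natrM; apply/idP/idP; lra.
have half' (i : nat) : (k%:R / 2 < i%:R :> R) = (k < i.*2)%N.
  rewrite -(ltr_nat R) -muln2 natrM; apply/idP/idP; lra.
have hE i : h i - (tau i)%:R = g i - i%:R by rewrite /g; lra.
have term (i : nat) : (i <= k)%N ->
    `|k%:R / 2 - i%:R| + sigma i * (m - k%:R / 2) <= `|h i - (tau i)%:R|.
  move=> le_ik; rewrite hE /sigma /m.
  have [lt_i|gt_i|->] := ltrgtP (i%:R : R) (k%:R / 2).
  - rewrite gtr0_sg ?subr_gt0 //.
    have := ler_norm (g i - i%:R); suff : g k./2 <= g i by lra.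
    have : (i <= k./2)%N by move: lt_i; rewrite half; lia.
    by rewrite leq_eqVlt => /predU1P[-> //|lt]; apply/ltW/g_dec; lia.
  - rewrite ltr0_sg ?subr_lt0 //.
    have := ler_norm (- (g i - i%:R)); rewrite normrN.
    suff : g i <= g k./2 by lra.
    have : (k./2 <= i)%N by move: gt_i; rewrite half'; lia.
    by rewrite leq_eqVlt => /predU1P[-> //|lt]; apply/ltW/g_dec; lia.
  - by rewrite subrr sgr0 mul0r addr0.
(* The strictness comes from the index [k], since [k./2 < k]. *)
have last_term :
    `|k%:R / 2 - k%:R| + sigma k * (m - k%:R / 2) < `|h k - (tau k)%:R|.
  have k0 : 0 < k%:R :> R by rewrite ltr0n.
  have neg : k%:R / 2 - k%:R < 0 :> R by lra.
  rewrite hE /sigma /m (ltr0_sg neg) (ltr0_norm neg).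
  have := ler_norm (- (g k - k%:R)); rewrite normrN.
  suff : g k < g k./2 by lra.
  by apply: g_dec; lia.
apply: (@le_lt_trans _ _
    (\sum_(i < k.+1) (`|k%:R / 2 - i%:R| + sigma i * (m - k%:R / 2)))).
  by rewrite big_split /= -mulr_suml sigma_sum mul0r addr0.
rewrite !big_ord_recr /=; apply: ler_ltD => //.
by apply: ler_sum => i _; apply: term; exact: ltnW.
Qed.

(** The error terms of unvisited states are nonnegative and are dropped. The list [c] records that
    there are [k.+1] distinct states for the adversary to use. *)
Lemma LPS_transitions_error (I : input R n) j b e :
  phase_span I j b e -> (0 < transitions (@LPS R n) I b e)%N ->
  let k := transitions (@LPS R n) I b e in
  (exists2 c : seq (state n), uniq c & size c = k.+1) /\
  \sum_(i < k.+1) `|k%:R / 2 - i%:R| < prediction_error I j b e.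
Proof.
move=> span k_gt0 k.
pose tau := saturation_time I b e; pose h := prediction I j.
pose r := [rel s s' | (tau s < tau s')%N && (h s' < h s)].
have [|s0 [l [pl sl]]] := @transitions_path _ _ I _ _ _ span (@LPS R n) r.
  move=> t le_bt lt_te nE; apply/andP; split.
    exact: (BLS_transition_saturation_time span LPS_BLS).
  exact: (LPS_transition_prediction span).
have uniq_c : uniq (s0 :: l).
  apply: (@sorted_uniq _ r) => // [s2 s1 s3|s] /=.
    move=> /andP[t12 h12] /andP[t23 h23].
    by rewrite (ltn_trans t12) ?(lt_trans h23).
  by rewrite ltnn.
split; first by exists (s0 :: l) => //=; rewrite sl.
pose x := nth s0 (s0 :: l).
have rx i : (i < k)%N -> r (x i) (x i.+1).
  by move=> lt_ik; have /pathP := pl; apply; rewrite sl.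
apply: (@lt_le_trans _ _ (\sum_(i < k.+1) `|h (x i) - (tau (x i))%:R|)).
  apply: (@reversed_order_error (h \o x) (tau \o x)) => // i /rx /andP[] //.
have -> : \sum_(i < k.+1) `|h (x i) - (tau (x i))%:R| =
    \sum_(s <- s0 :: l) `|h s - (tau s)%:R|.
  by rewrite (big_nth s0) big_mkord /= sl.
rewrite (big_uniq _ uniq_c) /prediction_error [leRHS](bigID (mem (s0 :: l))) /=.
by rewrite lerDl; apply: sumr_ge0.
Qed.
End LPS.

(* What the adversary may do from the j-th phase of [I] on: prescribe the
   saturation times [tau] of that phase, which is the last one completed. *)
Definition splice (R : realFieldType) (n : nat) (I : input R n) (j b : nat)
    (h : state n -> R) (h_inj : injective h) (tau : state n -> nat) : input R n.
Proof.
refine (@Input R n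
  (fun u s => if (u <= b)%N then task I u s else (tau s == u)%:R)
  (fun j' => if (j' < j)%N then prediction I j' else h) _ _).
- by move=> u s; case: ifP => _; [exact: task_ge0|exact: ler0n].
- by move=> j'; case: ifP => _; [exact: prediction_inj|].
Defined.

(** * Phases of a spliced input *)

Section Splice.
Variables (R : realFieldType) (n : nat) (I : input R n) (j b : nat).
Variables (h : state n -> R) (h_inj : injective h) (tau : state n -> nat).
Hypothesis clock_b : clock I b = (j, b).
Hypothesis tau_gt : forall s, (b < tau s)%N.
Let J := splice I j b h_inj tau.

Lemma splice_clock_past t : (t <= b)%N -> clock J t = clock I t.
Proof.
move=> le_tb; apply: eq_clock_task => u /andP[_ le_ut] s /=.
by rewrite (leq_trans le_ut le_tb).
Qed.

Lemma splice_saturated_since t s :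
  saturated_since J b t s = (tau s <= t)%N.
Proof.
(* The only cost of [s] after time [b] is a unit cost at time [tau s]. *)
suff cost : phase_cost J b t s = (tau s <= t)%:R.
  by rewrite /saturated_since cost; case: (_ <= t)%N; rewrite ?lexx // ler10.
elim: t => [|t IH].
  by rewrite /phase_cost big_geq //; have := tau_gt s; case: (tau s).
have [lt_tb|le_bt] := ltnP t b.
  have -> : (tau s <= t.+1)%N = false by have := tau_gt s; lia.
  by rewrite /phase_cost big_geq.
rewrite /phase_cost big_nat_recr //= -/(phase_cost J b t s) IH ltnNge le_bt /=.
by rewrite -natrD; congr _%:R; case: ltngtP; case: ltngtP; lia.
Qed.

Lemma splice_clock t s : (b <= t < tau s)%N -> clock J t = (j, b).
Proof.
elim: t => [|t IH] /andP[le_bt lt_t].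
  move: le_bt; rewrite leqn0 => /eqP b0.
  by rewrite splice_clock_past // -clock_b b0.
move: le_bt; rewrite leq_eqVlt => /predU1P[<-|].
  by rewrite splice_clock_past.
rewrite ltnS => le_bt.
have Et : clock J t = (j, b) by apply: IH; rewrite le_bt ltnW.
rewrite clockS /phase_start Et /=; case: ifP => // /forallP/(_ s).
by rewrite splice_saturated_since leqNgt lt_t.
Qed.

Section Completion.
Variable e : nat.
Hypothesis tau_le : forall s, (tau s <= e)%N.
Hypothesis tau_end : exists s, tau s = e.

Lemma splice_clock_end : clock J e = (j.+1, e).
Proof.
have [s Es] := tau_end; have := tau_gt s; rewrite Es.
case: e Es tau_le => // e' Es le_e lt_be.
have Ee : clock J e' = (j, b) by apply: (@splice_clock _ s); rewrite Es; lia.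
rewrite clockS /phase_start /phase Ee /=; case: ifP => // /negbT.
by rewrite negb_forall => /existsP[s']; rewrite splice_saturated_since le_e.
Qed.

Lemma splice_span : phase_span J j b e.
Proof.
by split; [rewrite splice_clock_past|exact: splice_clock_end].
Qed.

(** All tasks after [e] are zero, so the next phase is never completed and its error never
    counts. *)
Lemma splice_clock_future t : (e <= t)%N -> clock J t = (j.+1, e).
Proof.
elim: t => [|t IH]; first by rewrite leqn0 => /eqP <-; exact: splice_clock_end.
rewrite leq_eqVlt => /predU1P[<-|]; first exact: splice_clock_end.
rewrite ltnS => le_et; rewrite clockS /phase_start IH //=.
case: ifP => // /forallP/(_ ord0); rewrite /saturated_since /phase_cost.
rewrite big_nat big1 ?ler10 // => u /andP[lt_eu _] /=.
have lt_bu := leq_trans (tau_gt ord0) (leq_trans (tau_le ord0) (ltnW lt_eu)).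
by rewrite leqNgt lt_bu /= ltn_eqF // (leq_ltn_trans (tau_le ord0)).
Qed.

Lemma splice_saturation_time s : saturation_time J b e s = tau s.
Proof.
apply: saturation_time_eq => [||t lt_t]; first exact: tau_le.
  by rewrite splice_saturated_since.
by rewrite splice_saturated_since -ltnNge.
Qed.

(** Phases before [j] are those of [I], with the same predictions; phase [j] has the prescribed
    error; no later phase is completed. *)
Lemma splice_error_bounded eta0 :
  error_bounded I eta0 -> \sum_s `|h s - (tau s)%:R| <= eta0 ->
  error_bounded J eta0.
Proof.
move=> errI errJ j' b' e' span; have [Eb' Ee'] := span.
have lt_be : (b < e)%N := leq_trans (tau_gt ord0) (tau_le ord0).
have phJ t j1 b1 : clock J t = (j1, b1) -> phase J t = j1.
  by rewrite /phase => ->.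
have phb : phase J b = j by apply: (phJ _ _ b); rewrite splice_clock_past.
have phe : phase J e = j.+1 by apply: (phJ _ _ e); exact: splice_clock_end.
have [lt_j|gt_j|Ej] := ltngtP j' j.
- have le_eb : (e' <= b)%N.
    rewrite leqNgt; apply/negP => lt_be'.
    have Ec : clock J e' = clock J b.
      apply: eq_clock; apply/eqP; rewrite eqn_leq (phase_homo J (ltnW lt_be')).
      by rewrite phb (phJ _ _ _ Ee') lt_j.
    move: Ec lt_be'; rewrite Ee' splice_clock_past // clock_b => -[_ ->].
    by rewrite ltnn.
  have lt_be' := phase_span_lt span.
  have spanI : phase_span I j' b' e'.
    by split; rewrite -splice_clock_past //; lia.
  have Esat s : saturation_time J b' e' s = saturation_time I b' e' s.
    apply: eq_in_find => t; rewrite mem_iota /= add0n ltnS => le_te.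
    rewrite /saturated_since (@eq_phase_cost _ _ J I) //.
    move=> u /andP[_ le_ut] s' /=.
    by have -> : (u <= b)%N by lia.
  have := errI _ _ _ spanI; rewrite /prediction_error.
  by congr (_ <= _); apply: eq_bigr => s _; rewrite Esat /= lt_j.
- have phe' := phJ _ _ _ Ee'.
  have [le_ee|/ltnW le_ee] := leqP e' e.
    by have := phase_homo J le_ee; rewrite phe phe'; lia.
  by move: phe'; rewrite (phJ _ _ _ (splice_clock_future le_ee)); lia.
- have Eb : b' = b.
    have : clock J b' = clock J b.
      by apply: eq_clock; rewrite phb (phJ _ _ _ Eb').
    by rewrite Eb' splice_clock_past // clock_b => -[].
  have Ee : e' = e.
    have : clock J e' = clock J e.
      by apply: eq_clock; rewrite phe (phJ _ _ _ Ee') Ej.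
    by rewrite Ee' splice_clock_end => -[].
  rewrite Eb Ee; congr (_ <= _): errJ.
  by apply: eq_bigr => s _; rewrite splice_saturation_time /= Ej ltnn.
Qed.
End Completion.
End Splice.

(** Phases with exact predictions are spliced one after another, so all errors are 0. Hence the
    maximum in a worst case ranges over a nonempty set. *)
Lemma phase_span_exists (R : realFieldType) (n : nat) (eta0 : R) (j : nat) :
  0 <= eta0 ->
  exists (I : input R n) b e, error_bounded I eta0 /\ phase_span I j b e.
Proof.
move=> eta0_ge0.
have ord_natr_inj c : injective (fun s : state n => (c + s)%:R : R).
  by move=> s s' /eqP; rewrite eqr_nat eqn_add2l => /eqP/val_inj.
have extend (I : input R n) j' b :
    error_bounded I eta0 -> clock I b = (j', b) ->
    exists (J : input R n) e, error_bounded J eta0 /\ phase_span J j' b e.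
  move=> errI Eb; pose tau (s : state n) := (b.+1 + s)%N.
  have tau_gt s : (b < tau s)%N by rewrite /tau; lia.
  have tau_le s : (tau s <= b.+1 + n)%N by rewrite leq_add2l -ltnS.
  have tau_end : exists s, tau s = (b.+1 + n)%N by exists ord_max.
  exists (splice I j' b (ord_natr_inj b.+1) tau), (b.+1 + n)%N.
  split; last exact: splice_span.
  apply: splice_error_bounded tau_end _ errI _ => //.
  by rewrite big1 // => s _; rewrite subrr normr0.
suff [I [b [errI Eb]]] : exists (I : input R n) b,
    error_bounded I eta0 /\ clock I b = (j, b).
  by have [J [e ?]] := extend I j b errI Eb; exists J, b, e.
elim: j => [|j [I [b [errI Eb]]]]; last first.
  by have [J [e [errJ [_ Ee]]]] := extend I j b errI Eb; exists J, e.
pose I := @Input R n (fun _ _ => 0) (fun _ s => (0 + s)%:R) (fun _ _ => lexx 0)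
  (fun _ => ord_natr_inj 0%N).
have I0 t : clock I t = (0, 0)%N.
  elim: t => // t IH; rewrite clockS /phase_start IH.
  case: ifP => // /forallP/(_ ord0); rewrite /saturated_since /phase_cost.
  by rewrite big1 ?ler10.
by exists I, 0%N; split=> // j b e []; rewrite !I0 => _ [].
Qed.

(** * The strategy of the adversary *)

Lemma distinct_run_transitions (R : realFieldType) (n : nat)
    (A : algorithm R n) (J : input R n) (b k : nat) (l : seq (state n)) :
  uniq l -> size l = k.+1 ->
  (forall m, (m < k.+1)%N -> A J (b.+1 + m)%N = nth ord0 l m) ->
  (k <= transitions A J b (b.+2 + k))%N.
Proof.
move=> l_uniq l_size l_run; rewrite /transitions big_ltn; last by lia.
(* The move from time [b] to [b.+1] is discarded: the starting state may coincide with the first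
   entry of [l]. *)
apply: leq_trans (leq_addl _ _).
have {1}-> : k = (\sum_(b.+2 <= t < b.+2 + k) 1)%N.
  by rewrite sum_nat_const_nat muln1 addKn.
rewrite !big_nat; apply: (leq_sum (I := nat)) => t /andP[le_bt lt_t].
have -> : t.-1 = (b.+1 + (t - b.+2))%N by lia.
have {2}-> : t = (b.+1 + (t - b.+2).+1)%N by lia.
rewrite !l_run; try lia.
by rewrite /dist nth_uniq ?l_size; lia.
Qed.

(* The states outside [c] are saturated at once, and those of [l] one by one.
   The remaining states of [c] are only saturated after those of [l]; they have
   [index s l = size l]. *)
Definition hitting_time (n b : nat) (c l : seq (state n)) (s : state n) : nat :=
  if s \in c then (b.+2 + index s l)%N else b.+1.

Lemma hitting_time_gt (n b : nat) (c l : seq (state n)) s :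
  (b < hitting_time b c l s)%N.
Proof. by rewrite /hitting_time; case: ifP => _; lia. Qed.

Section Adversary.
Variables (R : realFieldType) (n : nat) (I : input R n) (j b : nat).
Variables (A : algorithm R n) (BLS_A : BLS_phase_algorithm A).
Hypothesis clock_b : clock I b = (j, b).
Variables (c : seq (state n)) (k : nat).
Hypotheses (c_uniq : uniq c) (c_size : size c = k.+1).
Variables (h : state n -> R) (h_inj : injective h).
Let J l := splice I j b h_inj (hitting_time b c l).

(** The tasks depend on [l], which lists the states that [A] occupies on these very tasks. The
    circle is broken by induction: appending the state occupied at time [b.+1 + i] alters only later
    tasks. *)
Lemma adversary_run i : (i <= k.+1)%N ->
  exists l, [/\ uniq l, size l = i, {subset l <= c}
    & forall m, (m < i)%N -> A (J l) (b.+1 + m)%N = nth ord0 l m].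
Proof.
elim: i => [|i IH] le_ik; first by exists [::].
have [l [l_uniq l_size l_sub l_run]] := IH (ltnW le_ik).
pose x := A (J l) (b.+1 + i)%N.
(* A state of [c] outside [l] keeps the phase in progress. *)
have [s0 s0c s0l] : exists2 s, s \in c & s \notin l.
  apply/hasP; rewrite has_predC; apply/negP => /allP sub.
  by have := uniq_leq_size c_uniq sub; rewrite c_size l_size; lia.
have clock_i : clock (J l) (b.+1 + i)%N = (j, b).
  apply: (@splice_clock _ _ _ _ _ _ _ _ clock_b (hitting_time_gt b c l) _ s0).
  by rewrite /hitting_time s0c memNindex // l_size; lia.
have := BLS_unsaturated BLS_A (J l) (b.+1 + i)%N.
rewrite -/x /saturated /phase_start clock_i /=.
rewrite splice_saturated_since; last exact: hitting_time_gt.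
rewrite -ltnNge => x_late.
have xc : x \in c.
  by apply: contraLR x_late => /negbTE xc; rewrite /hitting_time xc; lia.
have xl : x \notin l.
  apply/negP => xl; have := x_late; rewrite /hitting_time xc.
  by have := xl; rewrite -index_mem l_size; lia.
(* Only states of [c] outside [rcons l x] change their saturation time, from [b.+2 + i] to
   [b.+3 + i], both in the future. *)
have run_eq t : (t <= b.+1 + i)%N -> A (J (rcons l x)) t = A (J l) t.
  move=> le_t; apply: (BLS_online BLS_A) => [u /andP[_ le_ut] s|//] /=.
  case: ifP => // _; congr ((_ : bool)%:R).
  rewrite /hitting_time; case: ifP => // _.
  have [sl|sl] := boolP (s \in l); first by rewrite -cats1 index_cat sl.
  rewrite (memNindex sl) -cats1 index_cat (negbTE sl) l_size.
  by apply/idP/idP => /eqP; lia.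
exists (rcons l x); split.
- by rewrite rcons_uniq xl.
- by rewrite size_rcons l_size.
- by move=> s; rewrite mem_rcons inE => /predU1P[-> //|/l_sub].
- move=> m; rewrite ltnS => le_mi; rewrite run_eq ?leq_add2l //.
  rewrite nth_rcons l_size; move: le_mi.
  rewrite leq_eqVlt => /predU1P[->|lt_mi].
    by rewrite ltnn eqxx.
  by rewrite lt_mi l_run.
Qed.

End Adversary.

Lemma sum_error_uniq (R : realFieldType) (n : nat) (c : seq (state n))
    (F : state n -> R) : uniq c ->
  \sum_s (if s \in c then F s else 0) = \sum_(s <- c) F s.
Proof. by move=> c_uniq; rewrite -big_mkcond big_uniq. Qed.

(** The oracle must commit before the order [l] is known. Every order of [c] yields the same set of
    saturation times, so predicting their mean gives the same error for all orders, up to the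
    tie-breaking. *)
Lemma adversary_error (R : realFieldType) (n : nat) (b k : nat) (eta0 : R)
    (c : seq (state n)) :
  uniq c -> size c = k.+1 ->
  \sum_(i < k.+1) `|k%:R / 2 - i%:R| < eta0 ->
  exists h : state n -> R, injective h /\ forall l, uniq l -> size l = k.+1 ->
    {subset l <= c} -> \sum_s `|h s - (hitting_time b c l s)%:R| <= eta0.
Proof.
move=> c_uniq c_size lt_eta0.
pose E : R := \sum_(i < k.+1) `|k%:R / 2 - i%:R|; have lt_E : E < eta0 by [].
pose N : R := n.+1%:R; have N_ge1 : 1 <= N by rewrite ler1n.
(* A perturbation by [eps * s] breaks the ties. *)
pose eps : R := Num.min 1 (eta0 - E) / (N * N).
have eps_gt0 : 0 < eps.
  by rewrite divr_gt0 ?lt_min ?ltr01 ?subr_gt0 // mulr_gt0 //; lra.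
(* The [n.+1] perturbations, each at most [eps * N], add at most [eta0 - E] to the error. *)
have epsNN : eps * N * N = Num.min 1 (eta0 - E).
  by rewrite -mulrA /eps divfK // mulf_neq0 // pnatr_eq0.
have s_lt (s : state n) : s%:R + 1 <= N by rewrite natr1 ler_nat.
have epsN : eps * N <= 1.
  have : eps * N * N <= 1 by rewrite epsNN ge_min lexx.
  have : 0 < eps * N by rewrite mulr_gt0 //; lra.
  nra.
have eps_s (s : state n) : 0 <= eps * s%:R /\ eps * s%:R < 1.
  have := s_lt s; have : 0 <= s%:R :> R by []; nra.
(* The mean time in [c], the exact time outside. These values differ by at least 1, and any two
   perturbations by less. *)
pose base (s : state n) : R :=
  if s \in c then b.+2%:R + k%:R / 2 else b.+1%:R.
have k_ge0 : 0 <= k%:R :> R by [].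
exists (fun s => base s + eps * s%:R); split.
  move=> s s'; have [? ?] := eps_s s; have [? ?] := eps_s s'.
  have eq_s : eps * s%:R = eps * s'%:R -> s = s'.
    by move/(mulfI (lt0r_neq0 eps_gt0))/eqP; rewrite eqr_nat => /eqP/val_inj.
  rewrite /base; case: (s \in c); case: (s' \in c) => /= Eh;
    (try by apply: eq_s; lra); exfalso; move: Eh;
    rewrite -[b.+2%:R]natr1; lra.
move=> l l_uniq l_size l_sub.
have l_perm : perm_eq l c.
  apply: uniq_perm => //.
  by have [] := uniq_min_size l_uniq l_sub; rewrite ?c_size ?l_size.
apply: (@le_trans _ _ (\sum_s
    ((if s \in c then `|k%:R / 2 - (index s l)%:R| else 0) + eps * N))).
  apply: ler_sum => s _; rewrite /base /hitting_time.
  have [? ?] := eps_s s.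
  have : eps * s%:R <= eps * N by rewrite ler_pM2l //; have := s_lt s; lra.
  case: ifP => _ ?.
    rewrite natrD.
    have -> : b.+2%:R + k%:R / 2 + eps * s%:R - (b.+2%:R + (index s l)%:R) =
      (k%:R / 2 - (index s l)%:R) + eps * s%:R by lra.
    apply: le_trans (ler_normD _ _) _; rewrite lerD2l ger0_norm //.
  by rewrite addrC addKr add0r ger0_norm.
rewrite big_split /= sum_error_uniq // sumr_const card_ord.
rewrite -[_ *+ n.+1]mulr_natr -/N epsNN.
rewrite -(perm_big _ l_perm) (big_nth ord0) big_mkord l_size.
have -> : \sum_(i < k.+1) `|k%:R / 2 - (index (nth ord0 l i) l)%:R| = E.
  by apply: eq_bigr => i _; rewrite index_uniq ?l_size.
have : Num.min 1 (eta0 - E) <= eta0 - E by rewrite ge_min lexx orbT.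
lra.
Qed.

Lemma adversary (R : realFieldType) (n : nat) (I : input R n) (j b k : nat)
    (eta0 : R) (A : algorithm R n) (c : seq (state n)) :
  BLS_phase_algorithm A -> clock I b = (j, b) -> error_bounded I eta0 ->
  uniq c -> size c = k.+1 -> \sum_(i < k.+1) `|k%:R / 2 - i%:R| < eta0 ->
  exists (J : input R n) e, [/\ error_bounded J eta0, phase_span J j b e
    & (k <= transitions A J b e)%N].
Proof.
move=> BLS_A clock_b errI c_uniq c_size lt_E.
have [h [h_inj h_err]] := adversary_error b c_uniq c_size lt_E.
have [l [l_uniq l_size l_sub l_run]] :=
  adversary_run BLS_A clock_b c_uniq c_size h_inj (leqnn _).
(* As [l] exhausts [c], no saturation time exceeds [b.+2 + k]. *)
have c_sub : {subset c <= l}.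
  have [|_ eq_lc] := uniq_min_size l_uniq l_sub; first by rewrite c_size l_size.
  by move=> s; rewrite eq_lc.
have time_gt := hitting_time_gt b c l.
have time_le s : (hitting_time b c l s <= b.+2 + k)%N.
  rewrite /hitting_time; case: ifP => [/c_sub|_]; last by lia.
  by rewrite -index_mem l_size; lia.
have time_end : exists s, hitting_time b c l s = (b.+2 + k)%N.
  exists (nth ord0 l k); rewrite /hitting_time l_sub ?mem_nth ?l_size //.
  by rewrite index_uniq // l_size.
exists (splice I j b h_inj (hitting_time b c l)), (b.+2 + k)%N; split.
- by apply: splice_error_bounded time_end _ errI _ => //; exact: h_err.
- exact: splice_span.
- exact: (distinct_run_transitions l_uniq l_size l_run).
Qed.

(** * Comparison of the worst cases *)

Lemma worst_case_transitions_exists (R : realFieldType) (n : nat) (eta0 : R)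
    (A : algorithm R n) (j : nat) :
  0 <= eta0 -> BLS_phase_algorithm A ->
  exists w, worst_case_transitions eta0 A j w.
Proof.
move=> eta0_ge0 BLS_A.
pose attained k := exists (I : input R n) b e,
  [/\ error_bounded I eta0, phase_span I j b e & transitions A I b e = k].
have [|k [I [b [e [_ span <-]]]]|w [w_att w_max]] :=
    @ex_max_bounded attained n.
- have [I [b [e [errI span]]]] := phase_span_exists n j eta0_ge0.
  by exists (transitions A I b e), I, b, e.
- exact: BLS_transitions_le span _ BLS_A.
- exists w; split=> // I b e errI span.
  by apply: w_max; exists I, b, e.
Qed.

Theorem theorem3 (R : realFieldType) (n : nat) (eta0 : R)
    (eta0_ge0 : 0 <= eta0) :
  BLS_phase_algorithm (@LPS R n) /\
  forall A : algorithm R n, BLS_phase_algorithm A ->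
  forall j : nat, exists wLPS wA : nat,
    [/\ worst_case_transitions eta0 (@LPS R n) j wLPS,
        worst_case_transitions eta0 A j wA
      & (wLPS <= wA)%N].
Proof.
split=> [|A BLS_A j]; first exact: LPS_BLS.
have [wLPS worstLPS] := worst_case_transitions_exists j eta0_ge0 (@LPS_BLS R n).
have [wA worstA] := worst_case_transitions_exists j eta0_ge0 BLS_A.
(* The count 0 is split off: the error threshold is then 0, and the error of an input need not
   exceed it. *)
exists wLPS, wA; split=> //; have [-> //|w_gt0] := posnP wLPS.
case: worstLPS => -[I [b [e [errI span Ew]]]] _.
move: w_gt0; rewrite -Ew => w_gt0.
(* The worst input of [LPS] supplies the past, the states [c], and a threshold strictly below
   [eta0]. *)
have [[c c_uniq c_size] lt_err] := LPS_transitions_error span w_gt0.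
have [J [e' [errJ spanJ le_k]]] := adversary BLS_A span.1 errI c_uniq c_size
  (lt_le_trans lt_err (errI _ _ _ span)).
exact: leq_trans le_k (worstA.2 _ _ _ errJ spanJ).
Qed.
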